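(* Assume the Continuum Hypothesis. Let $X$ be a locally compact non-separable metrizable space. For a set $\mathcal{F}\subseteq\mathcal{E}(X)$ consider the following conditions. (1) For each $A\in\mathcal{F}$, $|\{Y\in\mathcal{E}(X):Y>A\}|\leq\aleph_1$. (2) If $A\in\mathcal{E}(X)$ is such that $|\{Y\in\mathcal{E}(X):Y>A\}|\leq\aleph_1$, then there exists a $B\in\mathcal{F}$ such that $B<A$. (3) For each $A,B\in\mathcal{F}$ such that $A<B$, there exists a $C\in\mathcal{F}$ such that $B\wedge C=A$ and $B$ and $C$ have no common upper bound in $\mathcal{E}(X)$. Then $\mathcal{E}_K(X)$ is the largest (with respect to set-theoretic inclusion) subset of $\mathcal{E}(X)$ satisfying conditions (1), (2) and (3); that is, $\mathcal{E}_K(X)$ satisfies them, and every $\mathcal{F}\subseteq\mathcal{E}(X)$ satisfying them is contained in $\mathcal{E}_K(X)$.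
   Context: For a non-compact metrizable space $X$, $\mathcal{E}(X)$ denotes the set of all one-point metrizable extensions of $X$, i.e. metrizable spaces $Y=X\cup\{p\}$ with $p\notin X$ containing $X$ as a dense subspace, where two such extensions are identified if there is a homeomorphism between them fixing $X$ pointwise. $\mathcal{E}(X)$ is partially ordered by: $Y_1\leq Y_2$ if there is a continuous function from $Y_2$ into $Y_1$ fixing $X$ pointwise; $Y_1<Y_2$ means $Y_1\le Y_2$ and $Y_1\neq Y_2$. The symbol $\wedge$ denotes the greatest lower bound in this order. For $X$ locally compact, $\mathcal{E}_K(X)$ is the set of those elements of $\mathcal{E}(X)$ that are locally compact. *)

(* Defs.v *)
From HB Require Import structures.
From mathcomp Require Import all_boot all_order all_algebra.
From mathcomp Require Import all_classical all_reals all_analysis.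

Set Implicit Arguments.
Unset Strict Implicit.
Unset Printing Implicit Defensive.

Local Open Scope classical_set_scope.
Local Open Scope card_scope.

Definition homeomorphism (S T : topologicalType) (f : S -> T) : Prop :=
  continuous f /\
  exists2 g : T -> S, continuous g & cancel f g /\ cancel g f.

Definition metrizable (R : realType) (T : topologicalType) : Prop :=
  exists (M : metricType R) (f : T -> M), homeomorphism f.

Definition separable (T : topologicalType) : Prop :=
  exists2 D : set T, countable D & dense D.

(* [W] has the least uncountable cardinality: it is uncountable, and no subset
   of it has a cardinality strictly between aleph_0 and that of [W]. *)
Definition is_aleph1 (T : Type) (W : set T) : Prop :=
  ~ countable W /\ forall V, V `<=` W -> countable V \/ V #= W.

Definition card_le_aleph1 (T : Type) (S : set T) : Prop :=
  exists (U : Type) (W : set U), is_aleph1 W /\ S #<= W.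

Definition continuum_hypothesis : Prop := is_aleph1 [set: set nat].

(* [Y], with [X] identified with its image under [e], is a metrizable space
   [X `|` {p}] containing [X] as a dense subspace.  [wopen e] is the initial
   topology along [e], so the second condition says that [e] is a topological
   embedding. *)
Definition one_point_metrizable_extension (R : realType)
    (X Y : topologicalType) (e : X -> Y) : Prop :=
  [/\ injective e, @open X = wopen e, dense (range e),
      exists p : Y, ~` range e = [set p]
    & metrizable R Y].

Record topology (T : Type) := Topology {
  top_open : set_system T ;
  top_openT : top_open setT ;
  top_openI : setI_closed top_open ;
  top_open_bigU : forall (I : Type) (f : I -> set T),
    (forall i, top_open (f i)) -> top_open (\bigcup_i f i) }.

Definition top_space (T : Type) (t : topology T) : Type := T.

HB.instance Definition _ (T : choiceType) (t : topology T) :=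
  Choice.on (top_space t).
HB.instance Definition _ (T : choiceType) (t : topology T) :=
  isOpenTopological.Build (top_space t)
    (@top_openT T t) (@top_openI T t) (@top_open_bigU T t).

Section extensions.
Context (R : realType) (X : topologicalType).

(* The set E(X).  The extra point is always [None] and the inclusion always
   [Some], so that an extension is a topology on [option X].  Each class of
   extensions modulo homeomorphisms fixing [X] contains exactly one of these:
   see [extension_ofP] and [extension_eqP] below. *)
Record extension := Extension {
  ext_top : topology (option X) ;
  ext_topP : one_point_metrizable_extension R (Some : X -> top_space ext_top) }.

Definition ext_space (Y : extension) : topologicalType :=
  top_space (ext_top Y).

Definition ext_incl (Y : extension) : X -> ext_space Y := Some.

Definition ext_le (Y1 Y2 : extension) : Prop :=
  exists2 f : ext_space Y2 -> ext_space Y1,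
    continuous f & forall x, f (ext_incl Y2 x) = ext_incl Y1 x.

Definition ext_lt (Y1 Y2 : extension) : Prop := ext_le Y1 Y2 /\ Y1 <> Y2.

(* The greatest lower bound of [B] and [C] exists and is [A]. *)
Definition is_glb (B C A : extension) : Prop :=
  [/\ ext_le A B, ext_le A C
    & forall D, ext_le D B -> ext_le D C -> ext_le D A].

Definition locally_compact_extensions : set extension :=
  [set Y | locally_compact [set: ext_space Y]].

Definition small_upper_cone (A : extension) : Prop :=
  card_le_aleph1 [set Y | ext_lt A Y].

Definition cond1 (F : set extension) : Prop :=
  forall A, F A -> small_upper_cone A.

Definition cond2 (F : set extension) : Prop :=
  forall A, small_upper_cone A -> exists2 B, F B & ext_lt B A.

Definition cond3 (F : set extension) : Prop :=
  forall A B, F A -> F B -> ext_lt A B ->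
  exists C, [/\ F C, is_glb B C A
    & ~ exists D, ext_le B D /\ ext_le C D].

End extensions.

(* The remaining lemmas validate the encoding of E(X). *)

Lemma homeomorphism_open (S T : topologicalType) (f : S -> T) (A : set T) :
  homeomorphism f -> open (f @^-1` A) <-> open A.
Proof.
move=> [cf [g cg [fK gK]]]; split=> [oA|]; last first.
  by move: A; apply/continuousP.
have -> : A = g @^-1` (f @^-1` A).
  by rewrite predeqE => y /=; rewrite gK.
by move/continuousP: cg; apply.
Qed.

Lemma homeomorphism_of_open (S T : topologicalType) (f : S -> T) (g : T -> S) :
  cancel f g -> cancel g f -> (forall A, open (f @^-1` A) <-> open A) ->
  homeomorphism f.
Proof.
move=> fK gK fo; split; first by apply/continuousP => A /fo.
exists g; last by []; apply/continuousP => A oA; apply/fo.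
suff -> : f @^-1` (g @^-1` A) = A by [].
by rewrite predeqE => y /=; rewrite fK.
Qed.

Lemma metrizable_hausdorff (R : realType) (T : topologicalType) :
  metrizable R T -> hausdorff_space T.
Proof.
move=> [M [f [cf [g cg [fK gK]]]]] p q pq; apply: (can_inj fK).
apply: (@metric_hausdorff R M) => A B fpA fqB.
have [z [Az Bz]] := pq _ _ (cf p _ fpA) (cf q _ fqB).
by exists (f z).
Qed.

Lemma topology_eq (T : Type) (s t : topology T) :
  top_open s = top_open t -> s = t.
Proof.
case: s t => [u1 a1 b1 c1] [u2 a2 b2 c2] /= e; case: _ / e a2 b2 c2 => a2 b2 c2.
by congr Topology; exact: Prop_irrelevance.
Qed.

Section adequacy.
Context (R : realType) (X : topologicalType).
Implicit Types Y Z : extension R X.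

Lemma extension_eqP Y Z :
  Y = Z <-> exists2 h : ext_space Y -> ext_space Z,
    homeomorphism h & forall x, h (ext_incl Y x) = ext_incl Z x.
Proof.
split=> [->|[h hh hX]].
  by exists id => //; split=> //; [move=> ? ?|exists id => //; move=> ? ?].
have hid y : h y = y.
  case: hh => ch [g cg [hK gK]].
  case: y => [x|]; first exact: hX.
  case E : (h None) => [x|//].
  by have := hX x; rewrite /ext_incl -E => /(can_inj hK).
case: Y Z h hh hX hid => [s sP] [t tP] h hh _ /= hid.
have st : s = t.
  apply: topology_eq; rewrite predeqE => A.
  have := @homeomorphism_open _ _ h A hh.
  by rewrite (_ : h @^-1` A = A)// predeqE => y /=; rewrite hid.
by case: _ / st tP h hh hid => tP *; congr Extension; exact: Prop_irrelevance.
Qed.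

Lemma ext_le_refl Y : ext_le Y Y.
Proof. by exists id => // ? ?. Qed.

Lemma ext_le_trans Y1 Y2 Y3 : ext_le Y1 Y2 -> ext_le Y2 Y3 -> ext_le Y1 Y3.
Proof.
move=> [f cf fX] [g cg gX]; exists (f \o g) => [y|x /=]; last by rewrite gX fX.
by apply: continuous_comp; [exact: cg|exact: cf].
Qed.

Lemma ext_endo_id Y (f : ext_space Y -> ext_space Y) : continuous f ->
  (forall x, f (ext_incl Y x) = ext_incl Y x) -> forall y, f y = y.
Proof.
move=> cf fX y; have [_ _ dX _ mY] := ext_topP Y.
apply: (metrizable_hausdorff mY) => A B.
rewrite (@nbhsE (ext_space Y)) => -[A' [oA' fA'] A'A].
rewrite (@nbhsE (ext_space Y)) => -[B' [oB' yB'] B'B].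
have ofA : open (f @^-1` A') by move/continuousP: cf; apply.
have [||z [[fz Bz] [x _ xz]]] := dX (f @^-1` A' `&` B').
- by exists y.
- exact: openI.
exists z; split; last exact: B'B.
by apply: A'A; move: fz; rewrite /= -xz fX.
Qed.

Lemma ext_le_anti Y Z : ext_le Y Z -> ext_le Z Y -> Y = Z.
Proof.
move=> [f cf fX] [g cg gX]; apply/extension_eqP; exists g => //.
split => //; exists f => //; split=> y.
- apply: (@ext_endo_id _ (f \o g)) => [z|x /=]; last by rewrite gX fX.
  by apply: continuous_comp; [exact: cg|exact: cf].
- apply: (@ext_endo_id _ (g \o f)) => [z|x /=]; last by rewrite fX gX.
  by apply: continuous_comp; [exact: cf|exact: cg].
Qed.

Lemma extension_ofP (Y : topologicalType) (e : X -> Y) :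
  one_point_metrizable_extension R e ->
  exists (Z : extension R X) (h : ext_space Z -> Y),
    homeomorphism h /\ forall x, h (ext_incl Z x) = e x.
Proof.
move=> [einj eo ed [p pE] [M [m mh]]].
pose h (z : option X) := if z is Some x then e x else p.
have pN x : e x <> p.
  move=> exp; have : (~` range e) p by rewrite pE.
  by apply; exists x.
have hinj : injective h.
  by move=> [x|] [y|] //= => [/einj->//|/pN[]|/esym/pN[]].
have hsurj y : exists z, h z = y.
  have [[x _ <-]|] := pselect (range e y); first by exists (Some x).
  by move=> yN; exists None; have : (~` range e) y by []; rewrite pE => ->.
have [g gK] := choice hsurj.
have hK : cancel h g by move=> z; apply: hinj; rewrite gK.
pose o : set_system (option X) := [set A | open (g @^-1` A)].
have oT : o setT by rewrite /o/= preimage_setT; exact: openT.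
have oI : setI_closed o.
  by move=> A B; rewrite /o/= preimage_setI; exact: openI.
have oU : forall (I : Type) (f : I -> set (option X)),
    (forall i, o (f i)) -> o (\bigcup_i f i).
  by move=> I f fo; rewrite /o/= preimage_bigcup; apply: bigcup_open => i _; exact: (fo i).
pose t := Topology oT oI oU.
have hh : homeomorphism (h : top_space t -> Y).
  apply: (@homeomorphism_of_open (top_space t) Y h g hK gK) => A.
  change (open (g @^-1` (h @^-1` A)) <-> open A).
  suff -> : g @^-1` (h @^-1` A) = A by [].
  by rewrite predeqE => y /=; rewrite gK.
have tP : one_point_metrizable_extension R (Some : X -> top_space t).
  split.
  - by move=> x y [].
  - rewrite eo predeqE => U; split=> -[A oA <-].
      by exists (h @^-1` A) => //; apply/homeomorphism_open.
    exists (g @^-1` A); first exact: oA.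
    by rewrite predeqE => x /=; rewrite -[e x]/(h (Some x)) hK.
  - move=> O [z Oz] oO; have [||y [Oy [x _ xy]]] := ed (g @^-1` O).
    + by exists (h z); rewrite /= hK.
    + exact: oO.
    exists (Some x); split; last by exists x.
    by move: Oy; rewrite /= -xy -[e x]/(h (Some x)) hK.
  - exists None; rewrite predeqE => -[x|]; split=> //.
      by move=> []; exists x.
    by move=> _ [].
  - exists M, (m \o h); case: mh hh => cm [n cn [mK nK]] [ch [k ck [hk kh]]].
    split; first by move=> z; apply: continuous_comp; [exact: ch|exact: cm].
    exists (k \o n); first by move=> z; apply: continuous_comp; [exact: cn|exact: ck].
    by split=> z /=; rewrite ?mK ?kh ?hk ?nK.
by exists (Extension tP), h.
Qed.

End adequacy.

(* Main.v *)
From HB Require Import structures.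
Require Import Defs.
From mathcomp Require Import all_boot all_order all_algebra.
From mathcomp Require Import all_classical all_reals all_analysis.
From mathcomp Require Import lra.

(** A one-point metrizable extension of [X] is described by a gauge: a
    positive continuous function [f] on [X] with infimum 0, the distance to
    the added point. Conversely every gauge comes from an extension
    ([extension_gauge], [gauge_extension]). The order becomes an inclusion of
    filters on [X] ([ext_le_coarser]), the minimum and the maximum of gauges
    describe meets and joins, and the extension is locally compact if and only
    if, for some [e], all the shells [r <= f <= e] are compact
    ([locally_compact_gauge]); such an [f] is called proper below.

    The key fact is that, under the continuum hypothesis, the upper cone of an
    extension has at most aleph_1 elements if and only if [f < e] is separable
    for some [e]. If it is, the extensions above are coded by sequences of
    open subsets of a separable set, hence by sets of integers
    ([small_upper_cone_of_subseparable]). If not, there are uncountably many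
    disjoint separable clopen pieces of [X] on each of which [f] has infimum
    0, and the subfamilies of these pieces yield too many extensions
    ([subseparable_of_small_upper_cone]).

    Proper gauges have separable sets [f < e], whence the first condition for
    the locally compact extensions. A separable subset of [X] lies in a
    separable clopen subset, which can be taken so large that its one-point
    compactification, together with the rest of [X], is a strictly smaller
    locally compact extension, whence the second condition
    ([proper_gauge_below]). For the third, the part of [A] away from [B] is
    again locally compact ([proper_gauge_complement]).

    Finally, let [F] satisfy the three conditions and let [A] be in [F]. By
    the first condition for [F] and the second one for the locally compact
    extensions, there is a locally compact [A' < A], and by the second
    condition for [F] some [B < A'] in [F]. The third condition, applied to [B
    < A], splits [B] into [A] and a part [C] far from [A]. Thus infinity for
    [A] is a clopen part of infinity for [B], and so of infinity for the
    intermediate, locally compact [A']. Therefore [A] is locally compact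
    ([proper_gauge_clopen_part]). *)

Set Implicit Arguments.
Unset Strict Implicit.
Unset Printing Implicit Defensive.

Import Order.TTheory GRing.Theory Num.Theory.

Local Open Scope classical_set_scope.
Local Open Scope ring_scope.
Local Open Scope card_scope.

(** * Cardinality *)

Lemma inj_on_card_le (T U : Type) (A : set T) (B : set U) (f : T -> U) :
  (forall x, A x -> B (f x)) ->
  (forall x y, A x -> A y -> f x = f y -> x = y) -> A #<= B.
Proof.
move=> fAB finj.
have /injfunPex[g] : exists2 g : T -> U, set_fun A B g & set_inj A g.
  by exists f => // x y /set_mem Ax /set_mem Ay; exact: finj.
exact: inj_card_le.
Qed.

Lemma card_le_inj_on (T U : Type) (A : set T) (B : set U) (x0 : T) :
  A x0 -> A #<= B ->
  exists2 f : T -> U, (forall x, A x -> B (f x)) &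
    (forall x y, A x -> A y -> f x = f y -> x = y).
Proof.
move=> Ax0 /card_leP[f].
have /choice[g gP] (x : T) : exists y : U,
    forall h : A x, y = set_val (f (SigSub (mem_set h))).
  have [Ax|nAx] := pselect (A x); last first.
    by exists (set_val (f (SigSub (mem_set Ax0)))) => h; case: nAx.
  exists (set_val (f (SigSub (mem_set Ax)))) => h.
  by rewrite (Prop_irrelevance h Ax).
exists g => [x Ax|x y Ax Ay].
  by rewrite (gP _ Ax); exact: set_valP.
rewrite (gP _ Ax) (gP _ Ay) => /val_inj e.
have /(congr1 val)// := @inj _ _ [set: A] f _ _ (mem_set I) (mem_set I) e.
Qed.

(** Comparability of cardinals: a maximal partial bijection between two sets
    exhausts one of them, for otherwise one more pair could be added. *)
Lemma card_le_total (T U : Type) (A : set T) (B : set U) :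
  A #<= B \/ B #<= A.
Proof.
pose P (G : set (T * U)) := [/\ G `<=` A `*` B,
  forall x y y', G (x, y) -> G (x, y') -> y = y' &
  forall x x' y, G (x, y) -> G (x', y) -> x = x'].
have [F FP Ftot|G [[GAB Gf Gi] Gmax]] := @Zorn_bigcup _ P.
  split=> [z [G /FP[GAB _ _]]|x y y' [G FG Gxy] [H FH Hxy']|
           x x' y [G FG Gxy] [H FH Hxy']]; first exact: GAB.
    have [GH|HG] := Ftot _ _ FG FH.
      by have [_ + _] := FP _ FH; apply; [exact: GH Gxy|exact: Hxy'].
    by have [_ + _] := FP _ FG; apply; [exact: Gxy|exact: HG Hxy'].
  have [GH|HG] := Ftot _ _ FG FH.
    by have [_ _] := FP _ FH; apply; [exact: GH Gxy|exact: Hxy'].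
  by have [_ _] := FP _ FG; apply; [exact: Gxy|exact: HG Hxy'].
have [dG|/existsNP[a /not_implyP[Aa nGa]]] :=
    pselect (forall a, A a -> exists b, G (a, b)).
  left; have [->|[x0 Ax0]] : A = set0 \/ A !=set0.
  - by have [|/set0P] := eqVneq A set0; [left|right].
  - exact: card_ge0.
  have [y0 Gxy0] := dG _ Ax0.
  have /choice[f fP] (x : T) : exists y, A x -> G (x, y).
    have [Ax|] := pselect (A x); last by exists y0.
    by have [y] := dG _ Ax; exists y.
  apply: (@inj_on_card_le _ _ _ _ f) => [x /fP/GAB[]//|x y /fP + /fP + e].
  by rewrite e; exact: Gi.
have [rG|/existsNP[b /not_implyP[Bb nGb]]] :=
    pselect (forall b, B b -> exists a, G (a, b)).
  right.
  have /choice[f fP] (y : U) : exists x, B y -> G (x, y).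
    have [By|] := pselect (B y); last by exists a.
    by have [x] := rG _ By; exists x.
  apply: (@inj_on_card_le _ _ _ _ f) => [x /fP/GAB[]//|x y /fP + /fP + e].
  by rewrite e; exact: Gf.
exfalso; apply: (Gmax (G `|` [set (a, b)])).
  split; first by move=> z; left.
  by move=> /(_ (a, b) (or_intror erefl)) Gab; apply: nGa; exists b.
split=> [z [/GAB//|->//]|x y y' [Gxy|[xa yb]] [Gxy'|[xa' yb']]
        |x x' y [Gxy|[xa yb]] [Gxy'|[xa' yb']]];
  do ?[by apply: Gf Gxy Gxy'|by apply: Gi Gxy Gxy'|by subst];
  subst; exfalso.
- by apply: nGa; exists y.
- by apply: nGa; exists y'.
- by apply: nGb; exists x.
- by apply: nGb; exists x'.
Qed.

(** If an uncountable set embeds in one of cardinality aleph_1, its image is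
    an uncountable subset, hence has the same cardinality by minimality of
    aleph_1; by comparability this is the only case to consider. *)
Lemma aleph1_card_le (T U : Type) (W : set T) (V : set U) :
  is_aleph1 W -> ~ countable V -> W #<= V.
Proof.
move=> [_ Wmin] Vunc.
have [//|VW] := card_le_total W V.
have [v0 Vv0] : V !=set0.
  by apply/set0P/eqP => V0; apply: Vunc; rewrite V0; exact: countable0.
have [f fVW finj] := card_le_inj_on Vv0 VW.
have fV : f @` V #= V.
  by apply: inj_card_eq => x y /set_mem Vx /set_mem Vy; exact: finj.
have [|cfV|] := Wmin (f @` V).
- by move=> _ [x Vx <-]; exact: fVW.
- by exfalso; apply: Vunc; rewrite -(eq_countable fV).
- rewrite card_eq_sym card_eqPle => -[Wf _].
  by apply: (card_le_trans Wf); exact: card_image_le.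
Qed.

(** Cantor's diagonal argument. *)
Lemma powerset_card_le (T : Type) (V : set T) : ~ ([set S | S `<=` V] #<= V).
Proof.
move=> le.
have [f fV finj] := @card_le_inj_on _ _ [set S | S `<=` V] V set0 (@sub0set _ V) le.
pose D := [set v | V v /\ exists S, [/\ S `<=` V, v = f S & ~ S v]].
have DV : D `<=` V by move=> v [].
have nD : ~ D (f D).
  move=> /[dup] Df [_ [S [SV fDS nSf]]]; apply: nSf.
  by rewrite -(finj _ _ DV SV fDS).
by apply: (nD); split; [exact: fV|exists D].
Qed.

(** * Metrizability in terms of distances *)

(** A distance carried by the given topological space itself, so that several
    spaces, in particular those of all the extensions, can be handled without
    transporting points along homeomorphisms. *)
Definition metrizes (R : realType) (T : topologicalType) (d : T -> T -> R) :=
  [/\ forall x, d x x = 0, forall x y, d x y = 0 -> x = y,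
      forall x y, d x y = d y x, forall y x z, d x z <= d x y + d y z
    & forall x A, nbhs x A <->
        exists2 e, 0 < e & forall y, d x y < e -> A y].

(** The parameter [dP] serves to attach to the type [T] the metric structure
    coming from [d]. *)
Definition metric_copy (R : realType) (T : topologicalType)
  (d : T -> T -> R) (dP : metrizes d) : Type := T.

Section metric_copy.
Context (R : realType) (T : topologicalType) (d : T -> T -> R).
Context (dP : metrizes d).

Let dxx (x : T) : d x x = 0. Proof. by case: dP. Qed.
Let d_eq (x y : T) : d x y = 0 -> x = y.
Proof. by case: dP => _ + _ _ _; apply. Qed.
Let d_sym (x y : T) : d x y = d y x. Proof. by case: dP. Qed.
Let d_tri (y x z : T) : d x z <= d x y + d y z.
Proof. by case: dP. Qed.

HB.instance Definition _ := Choice.on (metric_copy dP).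
HB.instance Definition _ :=
  @isMetric.Build R (metric_copy dP) d dxx d_eq d_sym d_tri.

Lemma metric_copy_homeomorphism :
  homeomorphism (id : T -> metric_copy dP).
Proof.
have nb (x : T) (A : set T) : @nbhs _ (metric_copy dP) x A <-> @nbhs _ T x A.
  have nbd : forall (x : T) (A : set T), nbhs x A <->
      exists2 e, 0 < e & forall y, d x y < e -> A y.
    by case: (dP).
  rewrite nbd -(@nbhs_ballE R (metric_copy dP)).
  split=> [[e /= e0 eA]|[e e0 eA]]; exists e => // y;
    by [move=> /eA|rewrite (@ballEmdist R (metric_copy dP)); exact: eA].
split; first by move=> x A /nb.
by exists (id : metric_copy dP -> T) => // x A /nb.
Qed.

End metric_copy.

Lemma metrizableP (R : realType) (T : topologicalType) :
  metrizable R T <-> exists d : T -> T -> R, metrizes d.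
Proof.
split=> [[M [f [cf [g cg [fK gK]]]]]|[d dP]]; last first.
  by exists (metric_copy dP), id; exact: metric_copy_homeomorphism.
exists (fun x y => mdist (f x) (f y)); split.
- by move=> x; rewrite mdistxx.
- by move=> x y /mdist_positivity/(can_inj fK).
- by move=> x y; exact: metric_sym.
- by move=> x y z; exact: metric_triangle.
move=> x A; split=> [Ax|[e e0 eA]].
  have : nbhs (f x) (g @^-1` A) by apply: cg; rewrite fK.
  rewrite -nbhs_ballE => -[e /= e0 eA]; exists e => // y xy.
  by rewrite -(fK y); apply: eA; rewrite ballEmdist.
have : nbhs x (f @^-1` ball (f x) e) by apply: cf; exact: nbhsx_ballx.
by apply: filterS => y /=; rewrite ballEmdist; exact: eA.
Qed.

(** * Metric spaces: continuity and compactness *)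

Section metric.
Context (R : realType) (X : topologicalType) (d : X -> X -> R).
Context (dP : metrizes d).

Lemma dxx x : d x x = 0. Proof. by case: dP. Qed.

Lemma d_eq x y : d x y = 0 -> x = y. Proof. by case: dP => _ + _ _ _; apply. Qed.

Lemma d_sym x y : d x y = d y x. Proof. by case: dP. Qed.

Lemma d_tri y x z : d x z <= d x y + d y z. Proof. by case: dP. Qed.

Lemma d_ge0 x y : 0 <= d x y.
Proof. by have := d_tri y x x; rewrite dxx (d_sym y x); lra. Qed.

Lemma nbhs_d x A :
  nbhs x A <-> exists2 e, 0 < e & forall y, d x y < e -> A y.
Proof. by case: dP. Qed.

Lemma open_d (A : set X) : open A <->
  forall x, A x -> exists2 e, 0 < e & forall y, d x y < e -> A y.
Proof.
rewrite openE; split=> oA x /oA; first by move/nbhs_d.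
by move=> ?; apply/nbhs_d.
Qed.

(** Continuity in terms of distances; the gauges below are built by elementary
    estimates. *)
Definition eps_continuous (f : X -> R) := forall x e, 0 < e ->
  exists2 r, 0 < r & forall y, d x y < r -> `|f y - f x| < e.

Lemma eps_continuous_max f g : eps_continuous f -> eps_continuous g ->
  eps_continuous (fun x => Num.max (f x) (g x)).
Proof.
move=> cf cg x e e0; have [r r0 rf] := cf x e e0; have [s s0 sg] := cg x e e0.
exists (Num.min r s); first by rewrite lt_min r0.
move=> y; rewrite lt_min => /andP[/rf + /sg].
rewrite !ltr_norml => /andP[f1 f2] /andP[g1 g2].
by case: (leP (f y) (g y)) => ?; case: (leP (f x) (g x)) => ?;
  apply/andP; split; lra.
Qed.

Lemma eps_continuousN f : eps_continuous f -> eps_continuous (fun x => - f x).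
Proof.
move=> cf x e e0; have [r r0 rf] := cf x e e0; exists r => // y /rf.
by rewrite -opprB opprK addrC normrN.
Qed.

Lemma eps_continuous_min f g : eps_continuous f -> eps_continuous g ->
  eps_continuous (fun x => Num.min (f x) (g x)).
Proof.
move=> /eps_continuousN cf /eps_continuousN cg.
have := eps_continuousN (eps_continuous_max cf cg).
by congr eps_continuous; apply/funext => x; rewrite oppr_max !opprK.
Qed.

Lemma eps_continuousB_cst c f :
  eps_continuous f -> eps_continuous (fun x => c - f x).
Proof.
move=> /eps_continuousN cf x e e0; have [r r0 rf] := cf x e e0.
by exists r => // y /rf; congr (`|_| < _); lra.
Qed.

Lemma eps_continuous_lip (f : X -> R) :
  (forall x y, f x <= f y + d x y) -> eps_continuous f.
Proof.
move=> fl x e e0; exists e => // y xy; have := fl x y; have := fl y x.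
by rewrite (d_sym y x) ltr_norml => ? ?; apply/andP; split; lra.
Qed.

Lemma eps_continuous_open f e : eps_continuous f -> open [set x | f x < e].
Proof.
move=> cf; apply/open_d => x /= fx.
have [|r r0 rf] := cf x (e - f x); first by rewrite subr_gt0.
by exists r => // y /rf; rewrite ltr_norml => /andP[_]; lra.
Qed.

Lemma eps_continuous_openr f e : eps_continuous f -> open [set x | e < f x].
Proof.
move=> /eps_continuousN/(@eps_continuous_open _ (- e)).
by congr open; apply/seteqP; split => x /=; rewrite ltrN2.
Qed.

Lemma eps_continuous_closed f e : eps_continuous f -> closed [set x | f x <= e].
Proof.
move=> /(@eps_continuous_openr _ e)/open_closedC.
by congr closed; apply/seteqP; split => x /=; rewrite leNgt => /negP.
Qed.

Lemma eps_continuous_closedr f e : eps_continuous f -> closed [set x | e <= f x].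
Proof.
move=> /(@eps_continuous_open _ e)/open_closedC.
by congr closed; apply/seteqP; split => x /=; rewrite leNgt => /negP.
Qed.

(** The cover criterion for compact sets in its filter form, applied to the
    filter of large integers. *)
Lemma compact_bigcup_open (K : set X) (U : nat -> set X) : compact K ->
  (forall n, open (U n)) -> (forall m n, (m <= n)%N -> U m `<=` U n) ->
  K `<=` \bigcup_n U n -> exists n, K `<=` U n.
Proof.
move=> cK oU Ule KU.
move: cK => /compact_near_coveringP/(_ nat \oo (fun n x => U n x) _).
suff H x : K x -> \forall x' \near x & i \near \oo, U i x'.
  by move=> /(_ H)[N _ NK]; exists N; apply: NK => /=.
move=> Kx.
have [n _ Unx] := KU _ Kx.
exists (U n, [set k | (n <= k)%N]) => /=.
  split; last by exists n.
  by rewrite nbhsE; exists (U n) => //; split.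
by move=> [y k] [/= Uy nk]; exact: Ule Uy.
Qed.

Lemma compact_lower_bound (K : set X) f : compact K -> eps_continuous f ->
  (forall x, K x -> 0 < f x) -> exists2 c, 0 < c & forall x, K x -> c <= f x.
Proof.
move=> cK cf f0.
have [n||x /f0 fx|n Kn] := @compact_bigcup_open K
    (fun n => [set x | n.+1%:R^-1 < f x]) cK.
- exact: eps_continuous_openr.
- move=> m n mn x /= ; apply: le_lt_trans.
  by rewrite lef_pV2 ?posrE// ler_nat.
- have [n nf] := ltr_add_invr fx.
  by exists n => //=; rewrite add0r in nf.
by exists n.+1%:R^-1 => // x /Kn /ltW.
Qed.

End metric.

(** * Extensions and gauges *)

Section gauges.
Context (R : realType) (X : topologicalType) (d : X -> X -> R).
Context (dP : metrizes d).
Implicit Types (f g h : X -> R) (Y Z : extension R X).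

(** A gauge plays the role of the distance to the point at infinity: the sets
    [f < e] are to form a base of the traces on [X] of its neighborhoods. *)
Definition gauge f :=
  [/\ eps_continuous d f, forall x, 0 < f x
    & forall e, 0 < e -> exists x, f x < e].

(** The open sets of the extension which the gauge [f] describes. *)
Definition gauge_open f (V : set (option X)) :=
  open (Some @^-1` V) /\
  (V None -> exists2 e, 0 < e & forall x, f x < e -> V (Some x)).

Definition gauge_of f Y :=
  gauge f /\ forall V, top_open (ext_top Y) V <-> gauge_open f V.

(** The distance to the added point, for a metric of the extension, is a gauge
    of it: it takes arbitrarily small values because [X] is dense. *)
Lemma extension_gauge Y : exists f, gauge_of f Y.
Proof.
have [_ emb dns _ /metrizableP[r rP]] := ext_topP Y.
pose f (x : X) : R := r (Some x) None.
have cf : eps_continuous d f.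
  move=> x e e0.
  have : nbhs (Some x : top_space (ext_top Y)) [set y | r (Some x) y < e].
    by apply/(nbhs_d rP); exists e.
  rewrite nbhsE => -[V [oO Ox] Oe].
  have : open (Some @^-1` V : set X) by rewrite emb; exists V.
  move=> /(open_d dP)/(_ _ Ox)[s s0 sO]; exists s => // y /sO/Oe /= xy.
  have := d_tri rP (Some x) (Some y) None.
  have := d_tri rP (Some y) (Some x) None.
  rewrite (d_sym rP (Some y) (Some x)) ltr_norml /f /= => ? ?.
  by apply/andP; split; lra.
have f0 x : 0 < r (Some x) None.
  by rewrite lt_neqAle (d_ge0 rP) andbT; apply/eqP => /esym/(d_eq rP).
exists f; split.
  split=> // e e0.
  have oB : open [set y | r None y < e].
    apply/(open_d rP) => y /= ye; exists (e - r None y); first by rewrite subr_gt0.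
    by move=> z yz; have := d_tri rP y None z; lra.
  have [|z [/= ze [x _ xz]]] := dns _ _ oB.
    by exists None; rewrite /= (dxx rP).
  by exists x; rewrite /f (d_sym rP) xz.
move=> V; split=> [oO|[oO ON]].
  split; first by rewrite emb; exists V.
  move=> ON; have /(open_d rP)/(_ _ ON)[e e0 eO] :
    open (V : set (top_space (ext_top Y))) by [].
  by exists e => // x xe; apply: eO; rewrite (d_sym rP).
apply/(open_d rP) => -[x|] Ox; last first.
  have [e e0 eO] := ON Ox; exists e => // -[y|//] /=.
  by rewrite (d_sym rP) => /eO.
move: oO; rewrite emb => -[V' oO' OO'].
have V'x : V' (Some x) by move: Ox; rewrite -[V _]/((Some @^-1` V) x) -OO'.
have [e e0 eO'] := (open_d rP V').1 oO' _ V'x.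
exists (Num.min e (f x)); first by rewrite lt_min e0 f0.
move=> [y|]; rewrite lt_min => /andP[xe xf]; last by rewrite /f ltxx in xf.
by rewrite -[V _]/((Some @^-1` V) y) -OO'; exact: eO'.
Qed.

(** A metric of the extension described by [f]: two points of [X] are either
    joined directly, at cost [d a b + `|f a - f b|], or through the point at
    infinity, at cost [f a + f b]. The term [`|f a - f b|] makes [f]
    1-Lipschitz, whence the triangle inequality. *)
Definition gauge_dist f (y z : option X) : R :=
  match y, z with
  | Some a, Some b => Num.min (d a b + `|f a - f b|) (f a + f b)
  | Some a, None => f a
  | None, Some b => f b
  | None, None => 0
  end.

Lemma gauge_dist_tri f : (forall x, 0 < f x) -> forall y x z,
  gauge_dist f x z <= gauge_dist f x y + gauge_dist f y z.
Proof.
move=> f0 [b|] [a|] [c|] /=; rewrite ?addr0 ?add0r //.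
- have := d_ge0 dP a b; have := d_ge0 dP b c.
  have := d_tri dP b a c; have := f0 a; have := f0 b; have := f0 c.
  have := ler_distD (f b) (f a) (f c).
  have := ler_norm (f a - f b); have := ler_norm (f b - f c).
  have := ler_norm (f b - f a); have := ler_norm (f c - f b).
  rewrite (distrC (f b) (f a)) (distrC (f c) (f b)) => ? ? ? ? ? ? ? ? ? ? ?.
  by rewrite ge_min; apply/orP; case: (leP (d a b + _)) => ?;
    case: (leP (d b c + _)) => ?; [left|right|right|right]; lra.
- have := d_ge0 dP a b; have := f0 b; have := ler_norm (f a - f b) => ? ? ?.
  by case: (leP (d a b + _)) => ?; lra.
- have := d_ge0 dP b c; have := f0 b; have := ler_norm (f c - f b).
  by rewrite distrC => ? ? ?; case: (leP (d b c + _)) => ?; lra.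
- by have := f0 b; lra.
- by rewrite ge_min lexx orbT.
Qed.

Lemma gauge_dist_sym f x y : gauge_dist f x y = gauge_dist f y x.
Proof.
by case: x y => [a|] [b|] //=; rewrite (d_sym dP) distrC [f a + _]addrC.
Qed.

Lemma gauge_dist_le f a b :
  gauge_dist f (Some a) (Some b) <= d a b + `|f a - f b|.
Proof. by rewrite /= ge_min lexx. Qed.

(** The converse of [extension_gauge]: every gauge arises from an extension. *)
Lemma gauge_extension f : gauge f -> exists Y, gauge_of f Y.
Proof.
move=> [cf f0 fN]; pose o : set_system (option X) := gauge_open f.
have oT : o setT by split; [exact: openT|move=> _; exists 1].
have oI : setI_closed o.
  move=> A B [oA NA] [oB NB]; split; first exact: openI.
  move=> [/NA[e e0 eA] /NB[r r0 rB]].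
  exists (Num.min e r); first by rewrite lt_min e0.
  by move=> x; rewrite lt_min => /andP[/eA ? /rB].
have oU : forall (I : Type) (A : I -> set (option X)),
    (forall i, o (A i)) -> o (\bigcup_i A i).
  move=> I A oA; split; first by apply: bigcup_open => i _; case: (oA i).
  move=> [i _ /(proj2 (oA i))[e e0 eA]]; exists e => // x /eA Ax.
  by exists i.
pose t := Topology oT oI oU; pose r := gauge_dist f.
have rxx x : r x x = 0.
  case: x => [a|] //=; rewrite (dxx dP) subrr normr0 addr0.
  by apply/min_idPl; rewrite addr_ge0// ltW.
have oB y e : o [set z | r y z < e].
  split.
    apply/(open_d dP) => x /= yx.
    have e0 : 0 < (e - r y (Some x)) / 2 by rewrite divr_gt0// subr_gt0.
    have [s s0 sf] := cf x _ e0.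
    exists (Num.min s ((e - r y (Some x)) / 2)); first by rewrite lt_min s0.
    move=> z; rewrite lt_min => /andP[/sf + xz].
    rewrite distrC => xz'.
    have := gauge_dist_tri f0 (Some x) y (Some z).
    by have := gauge_dist_le f x z; rewrite -/r; lra.
  move=> /= yN; exists (e - r y None); first by rewrite subr_gt0.
  move=> x fx; have := gauge_dist_tri f0 None y (Some x).
  have : r None (Some x) = f x by [].
  by rewrite -/r; lra.
have rP : @metrizes R (top_space t) r.
  split=> //; [|exact: gauge_dist_sym|exact: gauge_dist_tri|].
    move=> [a|] [b|] //=; last 2 first.
    - by rewrite /r /= => e; have := f0 a; rewrite e ltxx.
    - by rewrite /r /= => e; have := f0 b; rewrite e ltxx.
    have := f0 a; have := f0 b; have := d_ge0 dP a b.
    have := normr_ge0 (f a - f b); rewrite /r /=.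
    case: (leP (d a b + _)) => ? ? ? ? ? ?; last by exfalso; lra.
    by congr Some; apply: (d_eq dP); lra.
  move=> y A; rewrite nbhsE; split=> [[V [[oO NO] Oy] OA]|[e e0 eA]]; last first.
    exists [set z | r y z < e] => //; split; last by rewrite /= rxx.
    exact: oB.
  case: y Oy => [x|] Oy; last first.
    by have [e e0 eO] := NO Oy; exists e => // -[z|] /= ?;
      apply: OA => //; exact: eO.
  have [e e0 eO] := (open_d dP _).1 oO _ Oy.
  exists (Num.min e (f x)); first by rewrite lt_min e0 f0.
  move=> [z|]; rewrite lt_min => /andP[]; last by rewrite /r /= ltxx.
  rewrite /r /= => + xz; have := f0 z; have := normr_ge0 (f x - f z).
  move: xz; case: (leP (d x z + _)) => ? ? ? ? ?; last by exfalso; lra.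
  by apply/OA/eO; lra.
have P : one_point_metrizable_extension R (Some : X -> top_space t).
  split; first by move=> x y [].
  - apply/seteqP; split=> U.
      move=> oU'; exists (Some @` U).
        split; last by move=> [].
        rewrite (_ : _ @^-1` _ = U)//; apply/seteqP; split=> x; last by exists x.
        by move=> [y ? [<-]].
      by apply/seteqP; split=> x; [move=> [y ? [<-]]|exists x].
    by move=> [V [oO _] <-].
  - move=> V [[x|] Oz] [oO NO]; first by exists (Some x); split=> //; exists x.
    have [e e0 eO] := NO Oz; have [x /eO Ox] := fN _ e0.
    by exists (Some x); split=> //; exists x.
  - exists None; apply/seteqP; split=> -[x|] //=.
      by move=> [] //; exists x.
    by move=> _ [].
  - by apply/metrizableP; exists r.
by exists (Extension P).
Qed.

End gauges.

(** * Order and local compactness in terms of gauges *)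

Section order.
Context (R : realType) (X : topologicalType) (d : X -> X -> R).
Context (dP : metrizes d).
Implicit Types (f g h : X -> R) (Y Z : extension R X).

(** The order of extensions read on gauges: every neighborhood of infinity for
    [f] contains one for [g]. *)
Definition coarser f g :=
  forall e, 0 < e -> exists2 r, 0 < r & forall x, g x < r -> f x < e.

Lemma coarser_trans f g h : coarser f g -> coarser g h -> coarser f h.
Proof.
move=> fg gh e /fg[r /gh[s s0 sh] rg]; exists s => // x /sh; exact: rg.
Qed.

(** A continuous map fixing [X] sends the point at infinity to the point at
    infinity: were its image a point [x] of [X], points of [X] tending to
    infinity for [g] would tend to [x], where [g] is positive and continuous.
    Hence the map is the identity, and its continuity at infinity is the
    stated inclusion of filters. *)
Lemma ext_le_coarser f g Y Z : gauge_of d f Y -> gauge_of d g Z ->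
  ext_le Y Z <-> coarser f g.
Proof.
move=> [[cf f0 fN] fY] [[cg g0 gN] gZ]; split=> [[h ch hX]|fg]; last first.
  exists (id : ext_space Z -> ext_space Y) => //; apply/continuousP => A /fY[oA NA].
  apply/gZ; split=> // /NA[e /fg[r r0 rg] eA]; exists r => // x /rg; exact: eA.
(* Continuity of [h], read on the traces of open sets. *)
have oh (A : set (option X)) : gauge_open f A -> gauge_open g (h @^-1` A).
  by move=> /fY oA; apply/gZ; move/continuousP : ch => /(_ A); exact.
have hN : h None = None.
  case E : (h None) => [x|//]; exfalso.
  have [r r0 rg] := cg x (g x / 2) (divr_gt0 (g0 x) (ltr0n _ 2)).
  have [|_] := oh [set Some y | y in [set y | d x y < r]].
    split; last by move=> [].
    apply/(open_d dP) => y [z /= xz [<-]].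
    exists (r - d x z); first by rewrite subr_gt0.
    by move=> w zw; exists w => //=; have := d_tri dP z x w; lra.
  rewrite /= E => -[|e e0 eg]; first by exists x => //=; rewrite (dxx dP).
  have [|y] := gN (Num.min e (g x / 2)).
    by rewrite lt_min e0 divr_gt0.
  rewrite lt_min => /andP[/eg]; rewrite -[Some y]/(ext_incl Z y) hX.
  rewrite /ext_incl => -[z /= /rg + [<-]] {E}.
  by rewrite ltr_norml => /andP[? _] ?; lra.
move=> e e0; have [|_] := oh (None |` [set Some y | y in [set y | f y < e]]).
  split; last first.
    by move=> _; exists e => // x fx; right; exists x.
  rewrite (_ : _ @^-1` _ = [set x | f x < e]).
    exact: (eps_continuous_open dP).
  apply/seteqP; split=> x /=; last by move=> ?; right; exists x.
  by move=> [//|[y ? [<-]]].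
rewrite /= hN => -[|r r0 rg]; first by left.
exists r => // x /rg; rewrite -[Some x]/(ext_incl Z x) hX /ext_incl.
by move=> [//|[y ? [<-]]].
Qed.

Lemma coarser_anti f g Y Z : gauge_of d f Y -> gauge_of d g Z ->
  coarser f g -> coarser g f -> Y = Z.
Proof.
by move=> fY gZ fg gf; apply: ext_le_anti; apply/ext_le_coarser;
  [exact: fY|exact: gZ|exact: fg|exact: gZ|exact: fY|exact: gf].
Qed.

(** The minimum of two gauges describes the meet of the two extensions. *)
Lemma gauge_min f g : gauge d f -> gauge d g ->
  gauge d (fun x => Num.min (f x) (g x)).
Proof.
move=> [cf f0 fN] [cg g0 _]; split=> [|x|e /fN[x fx]].
- exact: eps_continuous_min.
- by rewrite lt_min f0 g0.
- by exists x; rewrite gt_min fx.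
Qed.

(** Local compactness at the point at infinity, as seen from [X]: the set [f
    <= e] together with that point is compact exactly when each shell [r <= f
    <= e] is, since what lies outside the shell converges to infinity as [r]
    decreases. *)
Definition proper_gauge f :=
  exists2 e, 0 < e & forall r, 0 < r -> compact [set x | r <= f x <= e].

Lemma eps_continuous_closed_between f a b : eps_continuous d f ->
  closed [set x | a <= f x <= b].
Proof.
move=> cf; rewrite (_ : [set x | _] = [set x | a <= f x] `&` [set x | f x <= b]).
  apply: closedI; first exact: (eps_continuous_closedr dP).
  exact: (eps_continuous_closed dP).
by apply/seteqP; split=> x /=; [move/andP|move=> [-> ->]].
Qed.

Lemma ext_incl_continuous Y : continuous (ext_incl Y).
Proof.
have [_ emb _ _ _] := ext_topP Y.
by apply/continuousP => A oA; rewrite emb; exists A.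
Qed.

(** [X] is embedded in its extensions, so that compactness can be tested in
    either space. *)
Lemma compact_ext_incl Y (K : set X) :
  compact K <-> compact (ext_incl Y @` K).
Proof.
split=> [cK|cK].
  apply: continuous_compact cK; apply: continuous_subspaceT.
  exact: ext_incl_continuous.
have [f [_ fY]] := extension_gauge dP Y.
move=> F FF FK; have [|_ [[x Kx <-] Fx]] := cK (fmap (ext_incl Y) F) _.
  by apply: (@filterS _ F _ K) FK => x Kx; exists x.
exists x; split=> // A B FA; rewrite nbhsE => -[U [oU Ux] UB].
have [||_ [[y Ay <-] [z Uz [zy]]]] :=
    Fx (ext_incl Y @` A) (ext_incl Y @` U).
- by apply: (@filterS _ F _ A) FA => y Ay; exists y.
- rewrite nbhsE; exists (ext_incl Y @` U) => //; split; last by exists x.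
  apply/fY; split; last by move=> [].
  rewrite (_ : _ @^-1` _ = U)//; apply/seteqP; split=> y; last by exists y.
  by move=> [z ? [<-]].
by exists y; split=> //; apply: UB; rewrite -zy.
Qed.

(** The compact neighborhoods of a point in [X] are still neighborhoods of it
    in the extension, and closed there because extensions are Hausdorff; the
    condition is thus about the added point only. *)
Lemma locally_compact_gauge f Y : locally_compact [set: X] -> gauge_of d f Y ->
  locally_compact [set: ext_space Y] <-> proper_gauge f.
Proof.
move=> Xlc fYY; have [[cf f0 fN] fY] := fYY; split=> [Ylc|[e e0 ec]].
  have [U /= + [cU clU]] := Ylc None I.
  rewrite withinET nbhsE => -[V [/fY[oV NV] VN] VU].
  have [e e0 eV] := NV VN; exists (e / 2); first by rewrite divr_gt0.
  move=> r r0; apply/(compact_ext_incl Y); apply: (subclosed_compact _ cU).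
    rewrite -openC; apply/fY; split.
      rewrite (_ : _ @^-1` _ = ~` [set x | r <= f x <= e / 2]).
        by apply: closed_openC; exact: eps_continuous_closed_between.
      apply/seteqP; split=> x /= nx => [fx|[y fy [yx]]]; apply: nx.
        by exists x.
      by rewrite -yx.
    by move=> _; exists r => // x fx [y /andP[+ _] [yx]]; rewrite yx; lra.
  by move=> _ [x /andP[_ fx] <-]; apply/VU/eV; lra.
have hY : hausdorff_space (ext_space Y).
  by have [_ _ _ _ mY] := ext_topP Y; exact: metrizable_hausdorff mY.
move=> [x|] _; rewrite withinET.
  have [U /=] := Xlc x I; rewrite withinET nbhsE => -[V [oV Vx] VU] [cU clU].
  exists (ext_incl Y @` U).
    rewrite nbhsE; exists (ext_incl Y @` V); last first.
      by move=> _ [y Vy <-]; exists y => //; exact: VU.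
    split; last by exists x.
    apply/fY; split; last by move=> [].
    rewrite (_ : _ @^-1` _ = V)//; apply/seteqP; split=> y; last by exists y.
    by move=> [z ? [<-]].
  have cU' : compact (ext_incl Y @` U) by apply/compact_ext_incl.
  by split=> //; exact: compact_closed.
pose U : set (ext_space Y) := None |` [set Some x | x in [set x | f x <= e]].
have Ue x : U (Some x) -> f x <= e by move=> [//|[y ? [<-]]].
have cU : compact U.
  move=> F FF FU; have [?|nN] := pselect (cluster F None).
    by exists None; split=> //; left.
  move: nN => /existsNP[A /existsNP[B /not_implyP[FA /not_implyP[]]]].
  rewrite nbhsE => -[V [/fY[_ NV] VN] VB] AB; have [r r0 rV] := NV VN.
  have [|y [[x /= fx xy] Fy]] := (compact_ext_incl Y _).1 (ec r r0) F FF.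
    apply: filterS (filterI FA FU) => -[x|] [Az Uz]; last first.
      by exfalso; apply: AB; exists None; split=> //; exact: VB.
    exists x => //; apply/andP; split; last exact: Ue.
    rewrite leNgt; apply/negP => /rV Vx; apply: AB; exists (Some x); split=> //.
    exact: VB.
  exists y; split=> //; rewrite -xy; right; exists x => //=.
  by move: fx => /andP[].
exists U; last by split=> //; exact: compact_closed.
rewrite nbhsE; exists (None |` [set Some x | x in [set x | f x < e]]); last first.
  by move=> _ [->|[x /ltW ? <-]]; [left|right; exists x].
split; last by left.
apply/fY; split; last by move=> _; exists e => // x ?; right; exists x.
rewrite (_ : _ @^-1` _ = [set x | f x < e]).
  exact: (eps_continuous_open dP).
apply/seteqP; split=> x /=; last by move=> ?; right; exists x.
by move=> [//|[y ? [<-]]].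
Qed.

End order.

(** * Separable subsets and clopen pieces of a locally compact space *)

Section separability.
Context (R : realType) (X : topologicalType) (d : X -> X -> R).
Context (dP : metrizes d) (x0 : X).
Implicit Types (S K M : set X).

(** The sequence [q] approximates the points of [S]; its terms may lie outside
    [S], which makes the notion obviously hereditary. *)
Definition separated_by (q : nat -> X) S :=
  forall x, S x -> forall e, 0 < e -> exists n, d (q n) x < e.

Definition subseparable S := exists q, separated_by q S.

Lemma subseparable_sub S M : S `<=` M -> subseparable M -> subseparable S.
Proof. by move=> SM [q qM]; exists q => x /SM; exact: qM. Qed.

Lemma subseparable_bigcup (I : countType) (F : I -> set X) :
  (forall i, subseparable (F i)) -> subseparable (\bigcup_i F i).
Proof.
move=> /choice[q qF].
exists (fun n => if unpickle n is Some (i, m) then q i m else x0).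
move=> x [i _ Fx] e /(qF _ _ Fx)[m me].
by exists (pickle (i, m)); rewrite pickleK.
Qed.

Lemma subseparableU S M :
  subseparable S -> subseparable M -> subseparable (S `|` M).
Proof.
move=> sS sM; apply: (@subseparable_sub _ (\bigcup_b (if b then S else M))).
  by move=> x [?|?]; [exists true|exists false].
by apply: subseparable_bigcup => -[].
Qed.

Lemma subseparable1 x : subseparable [set x].
Proof. by exists (fun=> x) => _ -> e e0; exists 0%N; rewrite (dxx dP). Qed.

Lemma subseparable_setT : subseparable [set: X] -> separable X.
Proof.
move=> [q qX]; exists (range q).
  exact: card_image_le.
move=> V [x Vx] /(open_d dP)/(_ _ Vx)[e e0 eV].
have [n ne] := qX x I e e0.
by exists (q n); split; [apply: eV; rewrite (d_sym dP)|exists n].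
Qed.

(** Total boundedness. The filter on finite sequences of points generated by
    the extensions of a given sequence turns the covering criterion for
    compact sets into the extraction of a finite net. *)
Lemma compact_net K e : compact K -> 0 < e ->
  exists s : seq X, forall x, K x -> exists2 y, y \in s & d y x < e.
Proof.
move=> /compact_near_coveringP cK e0.
pose F : set_system (seq X) :=
  [set A | exists s : seq X, forall t : seq X, {subset s <= t} -> A t].
have FF : Filter F.
  split; first by exists [::].
    move=> A B [s sA] [t tB]; exists (s ++ t) => u su; split.
      by apply: sA => x xs; apply: su; rewrite mem_cat xs.
    by apply: tB => x xt; apply: su; rewrite mem_cat xt orbT.
  by move=> A B AB [s sA]; exists s => t /sA/AB.
have H := cK _ F (fun s x => exists2 y, y \in s & d y x < e) FF.
suff /H[s sK] : forall x, K x -> \forall x' \near x & s \near F,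
    exists2 y, y \in s & d y x' < e by exists s; exact: sK.
move=> x Kx; exists ([set y | d x y < e], [set s | x \in s]) => /=.
  split; first by apply/(nbhs_d dP); exists e.
  by exists [:: x] => t; apply; rewrite mem_head.
by move=> [y s] [/= xy xs]; exists x.
Qed.

Definition rad (k : nat) : R := k.+1%:R^-1.

Lemma rad_gt0 k : 0 < rad k. Proof. by rewrite invr_gt0. Qed.

Lemma rad_le1 k : rad k <= 1. Proof. by rewrite invf_le1// ler1n. Qed.

Lemma rad_le k n : (k < n)%N -> rad n <= rad k.
Proof. by move=> kn; rewrite lef_pV2 ?posrE// ler_nat ltnS ltnW. Qed.

Lemma rad_lt e : 0 < e -> exists k, rad k < e.
Proof. by move=> /ltr_add_invr[k]; rewrite add0r => ke; exists k. Qed.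

Lemma compact_subseparable K : compact K -> subseparable K.
Proof.
move=> cK.
have /choice[s sK] (k : nat) : exists s : seq X,
    forall x, K x -> exists2 y, y \in s & d y x < rad k.
  by apply: compact_net => //; exact: rad_gt0.
exists (fun n => if unpickle n is Some (k, i) then nth x0 (s k) i else x0).
move=> x Kx e e0; have [k ke] := rad_lt e0.
have [y ys yx] := sK k x Kx.
exists (pickle (k, index y (s k))); rewrite pickleK nth_index//.
exact: lt_trans yx ke.
Qed.

Definition compact_ball x e :=
  exists2 K, compact K & forall y, d x y < e -> K y.

Lemma compact_ballS x y e r : d x y + r <= e -> compact_ball x e ->
  compact_ball y r.
Proof.
move=> xy [K cK Ke]; exists K => // z yz; apply: Ke.
by have := d_tri dP y x z; lra.
Qed.

(** A point reaches the points that are close to it in comparison with the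
    size of a ball around it contained in a compact set. The factor 4 leaves
    room to replace the centre by a nearby point of a dense sequence, and [k]
    keeps the possible radii countable. *)
Definition reach x y := exists k : nat,
  d x y < rad k /\ compact_ball x (4 * rad k).

(** Symmetrized so that the complement of a saturated set is saturated. *)
Definition step x y := reach x y /\ reach y x.

(** Unions of connected components of the graph of [step]. They decompose the
    locally compact space into open and closed pieces, a substitute for the
    partition of a locally compact paracompact space into sigma-compact ones. *)
Definition saturated M := forall x y, M x -> step x y -> M y.

Context (Xlc : locally_compact [set: X]).

Lemma compact_ball_near x : exists2 e, 0 < e & compact_ball x e.
Proof.
have [U /=] := @Xlc x I; rewrite withinET => /(nbhs_d dP)[e e0 eU] [cU _].
by exists e => //; exists U.
Qed.

Lemma step_near x : exists2 e, 0 < e & forall y, d x y < e -> step x y.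
Proof.
have [e e0 xe] := compact_ball_near x.
have [|k ke] := @rad_lt (e / 8); first by rewrite divr_gt0.
have k0 := rad_gt0 k.
exists (rad k) => // y xy; split; exists k; split=> //.
- by apply: compact_ballS xe; rewrite (dxx dP); lra.
- by rewrite (d_sym dP).
- by apply: compact_ballS xe; lra.
Qed.

Lemma saturated_open M : saturated M -> open M.
Proof.
move=> sM; apply/(open_d dP) => x Mx; have [e e0 xe] := step_near x.
by exists e => // y /xe; exact: sM.
Qed.

Lemma saturatedC M : saturated M -> saturated (~` M).
Proof. by move=> sM x y nMx [xy yx] My; apply: nMx; exact: sM My _. Qed.

Lemma saturated_closed M : saturated M -> closed M.
Proof. by move=> /saturatedC/saturated_open oM; rewrite -openC. Qed.

Lemma saturatedI M N : saturated M -> saturated N -> saturated (M `&` N).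
Proof.
by move=> sM sN x y [Mx Nx] xy; split; [exact: sM xy|exact: sN xy].
Qed.

Lemma saturated_bigcup I (P : set I) (M : I -> set X) :
  (forall i, P i -> saturated (M i)) -> saturated (\bigcup_(i in P) M i).
Proof.
by move=> sM x y [i Pi Mx] xy; exists i => //; exact: sM xy.
Qed.

Definition step_image S := [set y | exists2 x, S x & step x y].

(** Countably many compact balls, centred at the terms of a dense sequence,
    absorb all the points one step away. *)
Lemma subseparable_step_image S : subseparable S -> subseparable (step_image S).
Proof.
move=> [q qS].
pose F (nk : nat * nat) := [set y | d (q nk.1) y < 2 * rad nk.2 /\
  compact_ball (q nk.1) (3 * rad nk.2)].
apply: (@subseparable_sub _ (\bigcup_nk F nk)).
  move=> y [x Sx [[k [xy xk]] _]].
  have k0 := rad_gt0 k.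
  have [n nx] := qS x Sx _ k0.
  exists (n, k) => //; split => /=; first by have := d_tri dP x (q n) y; lra.
  by apply: compact_ballS xk; rewrite (d_sym dP); lra.
apply: subseparable_bigcup => -[n k].
have [[K cK Kn]|nc] := pselect (compact_ball (q n) (3 * rad k)).
  apply: subseparable_sub (compact_subseparable cK) => y [/= ny _]; apply: Kn.
  by apply: lt_le_trans ny _; rewrite ler_pM2r ?rad_gt0// ler_nat.
by exists q => y [].
Qed.

(** Saturating by iterated steps preserves separability, being a countable
    union. *)
Lemma saturated_hull S : subseparable S ->
  exists M, [/\ S `<=` M, saturated M & subseparable M].
Proof.
move=> sS; exists (\bigcup_n iter n step_image S); split.
- by move=> x Sx; exists 0%N.
- by move=> x y [n _ nx] xy; exists n.+1 => //; exists x.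
- by apply: subseparable_bigcup; elim=> //= n IH; exact: subseparable_step_image.
Qed.

(** A separable subset of a locally compact metric space is covered by a
    sequence of balls contained in compact sets. The supremum of their bump
    functions, all 1-Lipschitz and the [N]-th bounded by [rad N], is positive
    on the subset and vanishes at infinity. *)
Lemma vanishing_function M : subseparable M -> exists F : X -> R,
  [/\ eps_continuous d F, forall x, M x -> 0 < F x, forall x, 0 <= F x
    & forall e, 0 < e -> compact [set x | e <= F x]].
Proof.
move=> [q qM].
(* The factor [rad N] makes the bumps tend to 0 uniformly, so that only finitely
   many of them matter in [e <= F]. *)
pose c (N : nat) (x : X) : R :=
  if (unpickle N : option (nat * nat)) is Some (n, k) then
  if `[< compact_ball (q n) (rad k) >] then
    Num.max 0 (rad k - d (q n) x) * rad N else 0 else 0.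
have N0 := rad_gt0; have N1 := rad_le1.
have c0 N x : 0 <= c N x.
  rewrite /c; case: unpickle => [[n k]|//]; case: ifP => // _.
  by rewrite mulr_ge0 ?le_max ?lexx ?(ltW (N0 N)).
have c1 N x : c N x <= rad N.
  rewrite /c; case: unpickle => [[n k]|]; last exact: ltW.
  case: ifP => _; last exact: ltW.
  apply: ler_piMl; first exact/ltW/N0.
  rewrite ge_max ler01/=.
  by have := d_ge0 dP (q n) x; have := N1 k; lra.
have clip N x y : c N x <= c N y + d x y.
  rewrite /c; have xy0 := d_ge0 dP x y.
  case: unpickle => [[n k]|]; last by rewrite add0r.
  case: ifP => _; last by rewrite add0r.
  have : Num.max 0 (rad k - d (q n) x) <=
         Num.max 0 (rad k - d (q n) y) + d x y.
    have := d_tri dP x (q n) y => ?.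
    by case: (leP 0 (_ - d (q n) x)) => ?;
      case: (leP 0 (_ - d (q n) y)) => ?; lra.
  move=> /(ler_wpM2r (ltW (N0 N)))/le_trans; apply; rewrite mulrDl lerD2l.
  by rewrite ler_piMr.
pose F x := sup (range (c ^~ x)).
have hs x : has_sup (range (c ^~ x)).
  split; first by exists (c 0%N x); exists 0%N.
  by exists 1 => _ [N _ <-]; exact: le_trans (c1 N x) (N1 N).
have cF N x : c N x <= F x by apply: sup_upper_bound => //; exists N.
have Fc x r : (forall N, c N x <= r) -> F x <= r.
  by move=> cr; apply: ge_sup => [|_ [N _ <-]//]; exists (c 0%N x), 0%N.
have F0 x : 0 <= F x by exact: le_trans (c0 0%N x) (cF 0%N x).
have cont : eps_continuous d F.
  apply: (eps_continuous_lip dP) => x y; apply: Fc => N.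
  by apply: le_trans (clip N x y) _; rewrite lerD2r.
exists F; split=> // [x Mx|e e0].
  have [r r0 xr] := compact_ball_near x.
  have [|k kr] := @rad_lt (r / 2); first by rewrite divr_gt0.
  have [n nx] := qM x Mx _ (N0 k).
  apply: lt_le_trans (cF (pickle (n, k)) x); rewrite /c pickleK.
  case: asboolP => [_|[]]; last first.
    by apply: compact_ballS xr; rewrite (d_sym dP); have := N0 k; lra.
  by rewrite mulr_gt0// lt_max subr_gt0 nx orbT.
have [n ne] := rad_lt (divr_gt0 e0 (ltr0n _ 2)).
have /choice[K KP] (N : nat) : exists K, compact K /\
    forall x, 0 < c N x -> K x.
  rewrite /c; case: unpickle => [[m k]|]; last first.
    by exists set0; split; [exact: compact0|move=> x; rewrite ltxx].
  case: asboolP => [[K cK mK]|_]; last first.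
    by exists set0; split; [exact: compact0|move=> x; rewrite ltxx].
  exists K; split=> // x; rewrite pmulr_lgt0// lt_max ltxx /= subr_gt0.
  exact: mK.
apply: (@subclosed_compact _ _ (\big[setU/set0]_(i < n.+1) K i)).
- exact: (eps_continuous_closedr dP).
- by apply: bigsetU_compact => i _; case: (KP i).
move=> x /= xe.
have [_ [N _ <-] cN] : exists2 r, range (c ^~ x) r & e / 2 < r.
  have := sup_adherent (divr_gt0 e0 (ltr0n _ 2)) (hs x); rewrite -/(F x).
  by move=> [r ? ?]; exists r => //; lra.
have Nn : (N < n.+1)%N.
  rewrite ltnNge; apply/negP => nN; have := c1 N x.
  have := rad_le nN.
  by lra.
rewrite (bigD1 (Ordinal Nn))//=; left; apply: (KP N).2.
by apply: lt_trans cN; rewrite divr_gt0.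
Qed.

End separability.

(** * The size of upper cones *)

Section upper_cones.
Context (R : realType) (X : topologicalType) (d : X -> X -> R).
Context (dP : metrizes d) (x0 : X).

(** The basic balls contained in [U]: an open subset of a separable set is
    determined by such a set of pairs of integers. *)
Definition ball_code (q : nat -> X) (U : set X) : set (nat * nat) :=
  [set nk | forall y, d (q nk.1) y < rad R nk.2 -> U y].

Lemma ball_code_inj q S U V : separated_by d q S -> U `<=` S -> open U ->
  ball_code q U `<=` ball_code q V -> U `<=` V.
Proof.
move=> qS US /(open_d dP) oU UV x Ux; have [e e0 eU] := oU x Ux.
have [|k ke] := @rad_lt R (e / 2); first by rewrite divr_gt0.
have [n nx] := qS x (US x Ux) _ (rad_gt0 R k).
apply: (UV (n, k)) (nx) => y /= ny; apply: eU.
have := d_tri dP (q n) x y; rewrite (d_sym dP x (q n)). lra.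
Qed.

(** If [f < e] is separable, an extension above [A] is determined by the sets
    [g < rad k] intersected with [f < e], [g] being one of its gauges and [k]
    an integer. These are open subsets of a separable set, so the sequence is
    coded by a set of integers, and there are at most aleph_1 sets of integers
    under the continuum hypothesis. *)
Lemma small_upper_cone_of_subseparable (CH : continuum_hypothesis) f
    (A : extension R X) e :
  gauge_of d f A -> 0 < e -> subseparable d [set x | f x < e] ->
  small_upper_cone A.
Proof.
move=> fA e0 [q qS]; exists (set nat), setT; split; first exact: CH.
have /choice[g gP] := @extension_gauge R X d dP.
pose U Y k := [set x | g Y x < rad R k] `&` [set x | f x < e].
pose c Y : set nat := [set N |
  if (unpickle N : option (nat * (nat * nat))) is Some (k, nm)
  then ball_code q (U Y k) nm else False].
have oU Y k : open (U Y k).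
  have [[cf _ _] _] := fA; have [[cg _ _] _] := gP Y.
  by apply: openI; exact: (eps_continuous_open dP).
have cU Y Z k : c Y = c Z -> U Y k `<=` U Z k.
  move=> YZ; apply: (ball_code_inj qS) => // [x []//|nm].
  move: (congr1 (@^~ (pickle (k, nm))) YZ).
  by rewrite /c /= pickleK => ->.
(* The sets [U Y k] form a base of the filter of [Y], as [f < e] belongs to it. *)
have cle Y Z : coarser f (g Y) -> c Y = c Z -> coarser (g Z) (g Y).
  move=> /(_ e e0)[s s0 se] YZ r r0; have [k kr] := rad_lt r0.
  exists (Num.min s (rad R k)); first by rewrite lt_min s0 rad_gt0.
  move=> x; rewrite lt_min => /andP[/se fx gx].
  have [|+ _] := cU Y Z k YZ x; first by split.
  by move=> /lt_trans; exact.
apply: (@inj_on_card_le _ _ _ _ c) => // Y Z [AY _] [AZ _] YZ.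
move: AY AZ => /(ext_le_coarser dP fA (gP Y)) fY /(ext_le_coarser dP fA (gP Z)) fZ.
by apply: (coarser_anti dP (gP Y) (gP Z)); exact: cle.
Qed.

Context (Xlc : locally_compact [set: X]).

(** A separable open and closed piece of [X] reaching out to infinity for [f]. *)
Definition cusp (f : X -> R) (Q : set X) :=
  [/\ saturated d Q, subseparable d Q
    & forall e, 0 < e -> exists2 x, Q x & f x < e].

(** A maximal disjoint family of cusps cannot be countable: its union would be
    separable, so that each set [f < rad n] would have a point outside of it,
    and the saturated hull of these points, minus that union, would be a new
    cusp. *)
Lemma uncountable_disjoint_cusps (f : X -> R) :
  (forall e, 0 < e -> ~ subseparable d [set x | f x < e]) ->
  exists W : set (set X), [/\ W `<=` cusp f, ~ countable W
    & forall P Q x, W P -> W Q -> P x -> Q x -> P = Q].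
Proof.
move=> nsep.
have [W [Wcusp tW Wmax]] := ex_maximal_disjoint_subcollection id (cusp f).
exists W; split=> //; last first.
  by move=> P Q x WP WQ Px Qx; apply: tW => //; exists x.
move=> cW.
have sW : subseparable d (\bigcup_(Q in W) Q).
  have [->|[Q0 WQ0]] : W = set0 \/ W !=set0.
  - by have [|/set0P] := eqVneq W set0; [left|right].
  - by rewrite bigcup_set0; exists (fun=> x0).
  have [h _ hinj] := card_le_inj_on WQ0 cW.
  pose T (n : nat) := [set x | exists Q, [/\ W Q, h Q = n & Q x]].
  apply: (@subseparable_sub _ _ _ _ (\bigcup_n T n)).
    by move=> x [Q WQ Qx]; exists (h Q) => //; exists Q.
  apply: (subseparable_bigcup x0) => n.
  have [[Q [WQ Qn]]|nQ] := pselect (exists Q, W Q /\ h Q = n); last first.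
    by exists (fun=> x0) => x [Q [WQ Qn _]]; case: nQ; exists Q.
  have [_ sQ _] := Wcusp Q WQ; apply: subseparable_sub sQ => x [P [WP Pn Px]].
  by rewrite (hinj Q P) // Pn.
have satW : saturated d (\bigcup_(Q in W) Q).
  by apply: saturated_bigcup => Q /Wcusp[].
have pick n : exists x, f x < rad R n /\ ~ (\bigcup_(Q in W) Q) x.
  apply: contrapT => nx; apply: (nsep _ (rad_gt0 R n)).
  by apply: subseparable_sub sW => x fx; apply: contrapT => ?; apply: nx; exists x.
have /choice[a aP] := pick.
have [|M [aM Msat Msep]] := saturated_hull dP x0 (S := range a).
  by exists a => _ [n _ <-] e e0; exists n; rewrite (dxx dP).
(* The complement of a saturated set is saturated, hence so is [Q]. *)
pose Q := M `&` ~` \bigcup_(Q in W) Q.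
have Qa n : Q (a n) by have [_ na] := aP n; split=> //; apply: aM; exists n.
have Qcusp : cusp f Q.
  split; first by apply: saturatedI => //; exact: saturatedC.
    by apply: subseparable_sub Msep => x [].
  move=> e /rad_lt[n ne]; exists (a n) => //.
  by have [fa _] := aP n; exact: lt_trans ne.
apply: (Wmax (W `|` [set Q])).
- split; first by move=> P; left.
  move=> /(_ Q (or_intror erefl)) WQ; have [_] := Qa 0%N; apply.
  by exists Q.
- by move=> P [/Wcusp//|->].
- have QW P x : W P -> P x -> Q x -> False.
    by move=> WP Px [_]; apply; exists P.
  move=> P P' [WP|->] [WP'|->] [x [Px P'x]] //; first by apply: tW => //; exists x.
    by exfalso; exact: QW WP Px P'x.
  by exfalso; exact: QW WP' P'x Px.
Qed.

(** Otherwise there is an uncountable disjoint family [V] of cusps. Raising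
    [f] by 1 outside the union of a subfamily gives an extension strictly
    above [A], and distinct subfamilies give distinct extensions, because each
    cusp has points with [f] arbitrarily small. The upper cone then has more
    than aleph_1 elements. Two cusps are set apart: [P1] belongs to all the
    unions, so that the raised function is still a gauge, and [P0] to none, so
    that the extension is not [A]. *)
Lemma subseparable_of_small_upper_cone f (A : extension R X) :
  gauge_of d f A -> small_upper_cone A ->
  exists2 e, 0 < e & subseparable d [set x | f x < e].
Proof.
move=> fA [U [W [W1 le]]]; have [[cf f0 fN] _] := fA.
apply: contrapT => nsep.
have {}nsep e : 0 < e -> ~ subseparable d [set x | f x < e].
  by move=> e0 se; apply: nsep; exists e.
have [V [Vcusp Vunc Vdisj]] := uncountable_disjoint_cusps nsep.
have pick (V' : set (set X)) : ~ countable V' -> V' !=set0.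
  move=> V'unc; apply/set0P/eqP => V'0; apply: V'unc.
  by rewrite V'0; exact: countable0.
have del (V' : set (set X)) Q : ~ countable V' -> ~ countable (V' `\ Q).
  move=> V'unc cV'; apply: V'unc.
  have : countable (\bigcup_b (if b then [set Q] else V' `\ Q)).
    by apply: bigcup_countable => // -[] _; first exact: countable1.
  apply: sub_countable; apply: subset_card_le => P V'P.
  by have [->|] := pselect (P = Q); [exists true|exists false].
have [P0 VP0] := pick _ Vunc; have V0unc := del V P0 Vunc.
have [P1 [VP1 P10]] := pick _ V0unc; have V1unc := del _ P1 V0unc.
pose V1 := (V `\ P0) `\ P1; rewrite -/V1 in V1unc.
pose M (T : set (set X)) := \bigcup_(Q in P1 |` T) Q.
pose g T x := if `[< M T x >] then f x else f x + 1.
have gM T x : M T x -> g T x = f x by rewrite /g; case: asboolP.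
have gnM T x : ~ M T x -> g T x = f x + 1 by rewrite /g; case: asboolP.
have gf T x : f x <= g T x by rewrite /g; case: ifP => // _; lra.
have gM1 T x : g T x < 1 -> M T x.
  apply: contraPP => /gnM ->; have := f0 x; move=> ? ?; lra.
have TV T : T `<=` V1 -> P1 |` T `<=` V.
  by move=> TV1 Q [->//|/TV1[[]]].
have gauge_g T : T `<=` V1 -> gauge d (g T).
  move=> /TV TV'; split.
  - move=> x e e0; have [r r0 rf] := cf x e e0.
    have satM : saturated d (M T).
      by apply: saturated_bigcup => Q /TV'/Vcusp[].
    have [Mx|nMx] := pselect (M T x).
      have [s s0 sM] := (open_d dP _).1 (saturated_open dP Xlc satM) x Mx.
      exists (Num.min r s); first by rewrite lt_min r0.
      by move=> y; rewrite lt_min => /andP[/rf + /sM My]; rewrite !gM.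
    have [s s0 sM] := (open_d dP _).1
      (saturated_open dP Xlc (saturatedC satM)) x nMx.
    exists (Num.min r s); first by rewrite lt_min r0.
    move=> y; rewrite lt_min => /andP[/rf + /sM My]; rewrite !gnM//.
    by rewrite [f x + 1]addrC addrKA.
  - by move=> x; exact: lt_le_trans (gf T x).
  - move=> e e0; have [_ _ /(_ e e0)[x P1x fx]] := Vcusp _ VP1.
    by exists x; rewrite gM//; exists P1 => //; left.
have exY T : exists Y, T `<=` V1 -> gauge_of d (g T) Y.
  have [TV1|nT] := pselect (T `<=` V1); last by exists A.
  by have [Y] := gauge_extension dP (gauge_g T TV1); exists Y.
have [Y YP] := choice exY.
have notM T Q x : T `<=` V1 -> V Q -> Q <> P1 -> ~ T Q -> Q x -> ~ M T x.
  move=> /TV TV' VQ QP1 nTQ Qx [P TP Px].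
  have PQ : P = Q by apply: (Vdisj P Q x) => //; exact: TV'.
  by move: TP; rewrite PQ => -[].
have AY T : T `<=` V1 -> ext_lt A (Y T).
  move=> TV1; have gY := YP T TV1; split.
    apply/(ext_le_coarser dP fA gY) => e e0; exists e => // x.
    exact: le_lt_trans.
  move=> AY.
  have /(_ 1 ltr01)[r r0 rg] : coarser (g T) f.
    apply/(ext_le_coarser dP gY fA); rewrite -AY; exact: ext_le_refl.
  have [_ _ /(_ r r0)[x P0x /rg/gM1]] := Vcusp _ VP0.
  apply: (notM T P0 x) => // [P01|/TV1[[_ +] _]]; last exact.
  by apply: P10; rewrite P01.
have Yinj : forall T T' : set (set X), T `<=` V1 -> T' `<=` V1 ->
    Y T = Y T' -> T `<=` T'.
  move=> T T' TV1 T'V1 YTT' Q TQ; apply: contrapT => nT'Q.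
  have /(_ 1 ltr01)[r r0 rg] : coarser (g T') (g T).
    apply/(ext_le_coarser dP (YP _ T'V1) (YP _ TV1)); rewrite YTT'.
    exact: ext_le_refl.
  have [[VQ _] QP1] := TV1 _ TQ.
  have [_ _ /(_ r r0)[x Qx fx]] := Vcusp _ VQ.
  have /gM1 : g T' x < 1 by apply: rg; rewrite gM//; exists Q => //; right.
  exact: notM Qx.
apply: (@powerset_card_le _ V1); apply: card_le_trans (aleph1_card_le W1 V1unc).
apply: card_le_trans le; apply: (@inj_on_card_le _ _ _ _ Y) => //.
by move=> T T2 TV1 T2V1 e; apply/seteqP; split; apply: Yinj.
Qed.

End upper_cones.

(** * Constructions on proper gauges *)

Section proper_gauges.
Context (R : realType) (X : topologicalType) (d : X -> X -> R).
Context (dP : metrizes d) (x0 : X) (Xlc : locally_compact [set: X]).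
Implicit Types (f g h k : X -> R) (A B C D : extension R X).

Lemma proper_gauge_subseparable f : (forall x, 0 < f x) -> proper_gauge f ->
  exists2 e, 0 < e & subseparable d [set x | f x < e].
Proof.
move=> f0 [e e0 ec]; exists e => //.
apply: (@subseparable_sub _ _ _ _ (\bigcup_k [set x | rad R k <= f x <= e])).
  move=> x /= fe; have [k kx] := rad_lt (f0 x).
  by exists k => //=; rewrite !ltW.
apply: (subseparable_bigcup x0) => k; apply: (compact_subseparable dP x0).
exact/ec/rad_gt0.
Qed.

Lemma proper_gauge_small_upper_cone (CH : continuum_hypothesis) f A :
  gauge_of d f A -> proper_gauge f -> small_upper_cone A.
Proof.
move=> fA; have [[_ f0 _] _] := fA; move=> /(proper_gauge_subseparable f0)[e e0 se].
exact: (small_upper_cone_of_subseparable dP CH fA e0).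
Qed.

(** A space that is not separable is never exhausted by separable saturated
    sets. *)
Lemma saturated_chain (S : set X) : ~ subseparable d [set: X] -> subseparable d S ->
  exists M : nat -> set X, [/\ S `<=` M 0%N,
    forall n, saturated d (M n) /\ subseparable d (M n),
    forall n, M n `<=` M n.+1 & forall n, exists2 x, M n.+1 x & ~ M n x].
Proof.
move=> nsep sS.
have /choice[F FP] (T : set X) : exists T' : set X, subseparable d T ->
    [/\ T `<=` T', saturated d T', subseparable d T' & exists2 x, T' x & ~ T x].
  have [sT|] := pselect (subseparable d T); last by exists T.
  have [x nTx] : exists x, ~ T x.
    apply: contrapT => nx; apply: nsep; apply: subseparable_sub sT => x _.
    by apply: contrapT => ?; apply: nx; exists x.
  have [T' [TT' satT' sT']] :=
    saturated_hull dP x0 (subseparableU x0 sT (subseparable1 dP x)).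
  exists T' => _; split=> //; first by move=> y Ty; apply: TT'; left.
  by exists x => //; apply: TT'; right.
have sF n : subseparable d (iter n F S).
  by elim: n => //= n /FP[].
exists (fun n => iter n.+1 F S); split.
- by have [] := FP _ sS.
- by move=> n; split; [have [] := FP _ (sF n)|exact: (sF n.+1)].
- by move=> n; have [] := FP _ (sF n.+1).
- by move=> n; have [] := FP _ (sF n.+1).
Qed.

(** Let [N] be a separable saturated set containing [f < e], and take for [g]
    a function on [N] vanishing at infinity, extended by 1. On a compact
    subset of [N] the function [f] has a positive lower bound, so [g] is
    coarser than [f]. For [f] not to be coarser than [g], the part of [N]
    outside [f < e] must not be relatively compact: this is ensured by taking
    for [N] the union of a strictly increasing sequence of open and closed
    sets. *)
Lemma proper_gauge_below f e : ~ subseparable d [set: X] -> gauge d f -> 0 < e ->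
  subseparable d [set x | f x < e] ->
  exists g, [/\ gauge d g, proper_gauge g, coarser g f & ~ coarser f g].
Proof.
move=> nsep [cf f0 fN] e0 /(saturated_chain nsep)[M [fM sM MS Mneq]].
have Mle m n : (m <= n)%N -> M m `<=` M n.
  elim: n => [|n IH]; first by rewrite leqn0 => /eqP ->.
  by rewrite leq_eqVlt => /orP[/eqP ->//|/IH mn x /mn]; exact: MS.
pose N := \bigcup_n M n.
have satN : saturated d N by apply: saturated_bigcup => n _; case: (sM n).
have sepN : subseparable d N by apply: (subseparable_bigcup x0) => n; case: (sM n).
have [F [cF F0 Fge0 Fc]] := vanishing_function dP Xlc sepN.
(* No compact set contains [N] minus [M 0]: it would lie in some [M n]. *)
have KM (r : R) : 0 < r -> exists x, [/\ N x, F x < r & ~ M 0%N x].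
  move=> r0; apply: contrapT => nx.
  have cK : compact ([set x | r <= F x] `&` N).
    by apply: compact_closedI; [exact: Fc|exact: (saturated_closed dP Xlc)].
  have [n|||n Kn] := compact_bigcup_open (U := M) cK.
  - by case: (sM n) => satM _; exact: (saturated_open dP Xlc).
  - exact: Mle.
  - by move=> x [].
  have [x Mx nMx] := Mneq n; apply: nMx; have Nx : N x by exists n.+1.
  have [M0x|nM0x] := pselect (M 0%N x); first exact: Mle M0x.
  apply: Kn; split=> //=; rewrite leNgt; apply/negP => Fr.
  by apply: nx; exists x.
pose g x := if `[< N x >] then F x else 1.
have gN x : N x -> g x = F x by rewrite /g; case: asboolP.
have gnN x : ~ N x -> g x = 1 by rewrite /g; case: asboolP.
have cg : eps_continuous d g.
  move=> x r r0; have [Nx|nNx] := pselect (N x).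
    have [s s0 sF] := cF x r r0.
    have [t t0 tN] := (open_d dP _).1 (saturated_open dP Xlc satN) x Nx.
    exists (Num.min s t); first by rewrite lt_min s0.
    by move=> y; rewrite lt_min => /andP[/sF + /tN Ny]; rewrite !gN.
  have [t t0 tN] := (open_d dP _).1
    (saturated_open dP Xlc (saturatedC satN)) x nNx.
  by exists t => // y /tN Ny; rewrite !gnN// subrr normr0.
exists g; split.
- split=> // [x|r r0].
    by have [Nx|nNx] := pselect (N x); [rewrite gN// F0|rewrite gnN].
  by have [x [Nx Fx _]] := KM r r0; exists x; rewrite gN.
- exists (2^-1); first by rewrite invr_gt0.
  move=> r r0; apply: subclosed_compact (Fc r r0) _.
    exact: (eps_continuous_closed_between dP).
  move=> x /= /andP[]; have [Nx|nNx] := pselect (N x); first by rewrite gN.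
  by rewrite gnN// => _; lra.
- move=> r r0.
  have [c c0 fc] := compact_lower_bound dP (Fc r r0) cf (fun x _ => f0 x).
  exists (Num.min e c); first by rewrite lt_min e0.
  move=> x; rewrite lt_min => /andP[/fM M0x fx].
  rewrite gN; last by exists 0%N.
  by rewrite ltNge; apply/negP => /fc; rewrite leNgt fx.
- move=> /(_ e e0)[r r0 rf]; have [x [Nx Fx nM0x]] := KM r r0.
  by apply: nM0x; apply/fM/rf; rewrite gN.
Qed.

(** The shells of [g] being compact, [f] is bounded below on them, so that
    near infinity for [f] either [g] is small or [g > e2]. The gauge [max f
    (e2 - g)] retains the second part: it agrees with [f] there and is far
    from 0 where [g] is small. Together the two parts make up a neighborhood
    of infinity for [f], so that [f] is the meet of [g] and [h]. *)
Lemma proper_gauge_complement f g :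
  gauge d f -> gauge d g -> proper_gauge f -> proper_gauge g ->
  coarser f g -> ~ coarser g f ->
  exists h, [/\ gauge d h, proper_gauge h, coarser f h,
    forall k, coarser k g -> coarser k h -> coarser k f
    & exists2 e, 0 < e & forall x, g x < e -> h x < e -> False].
Proof.
move=> [cf f0 fN] [cg g0 gN] [e1 e10 fc] [e2 e20 gc] fg ngf.
(* Near infinity for [f], the shell [r <= g <= e2] is avoided. *)
have low r : 0 < r ->
    exists2 s, 0 < s & forall x, f x < s -> g x < r \/ e2 < g x.
  move=> r0.
  have [s s0 sf] := compact_lower_bound dP (gc r r0) cf (fun x _ => f0 x).
  exists s => // x fx; have [|rx] := ltP (g x) r; first by left.
  have [xe|] := leP (g x) e2; last by right.
  by have := sf x; rewrite /= rx xe => /(_ isT); rewrite leNgt fx.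
pose h x := Num.max (f x) (e2 - g x).
have fh x : f x <= h x by rewrite le_max lexx.
have gh x : e2 - g x <= h x by rewrite le_max lexx orbT.
have hf x : e2 < g x -> h x = f x.
  by move=> gx; apply: max_idPl; have := f0 x; lra.
have ch : eps_continuous d h.
  by apply: eps_continuous_max => //; exact: eps_continuousB_cst.
exists h; split.
- split=> // [x|e e0]; first exact: lt_le_trans (fh x).
  apply: contrapT => nx; apply: ngf => r r0.
  have [s s0 sf] := low r r0; exists (Num.min s e); first by rewrite lt_min s0.
  move=> x; rewrite lt_min => /andP[/sf[//|gx] fx]; exfalso; apply: nx.
  by exists x; rewrite hf.
- exists (Num.min e1 (e2 / 2)); first by rewrite lt_min e10 divr_gt0.
  move=> r r0; have e22 : 0 < e2 / 2 by rewrite divr_gt0.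
  apply: (subclosed_compact _ (compactU (fc r r0) (gc _ e22))).
    exact: (eps_continuous_closed_between dP).
  move=> x /= /andP[rh]; rewrite le_min => /andP[h1 h2].
  have [gx|gx] := leP (g x) e2.
    by right; apply/andP; split=> //; have := gh x; lra.
  by left; rewrite -hf// rh.
- by move=> e e0; exists e => // x; exact: le_lt_trans.
- move=> k kg kh e e0; have [r r0 rk] := kg e e0; have [s s0 sk] := kh e e0.
  have [t t0 tf] := low r r0; exists (Num.min s t); first by rewrite lt_min s0.
  move=> x; rewrite lt_min => /andP[fs /tf[/rk//|gx]]; apply: sk.
  by rewrite hf.
- exists (e2 / 2); first by rewrite divr_gt0.
  by move=> x; have := gh x; lra.
Qed.

(** The maximum of two gauges, if it takes arbitrarily small values, describes
    the join of the two extensions. *)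
Lemma common_upper_boundP f g B C : gauge_of d f B -> gauge_of d g C ->
  (exists D, ext_le B D /\ ext_le C D) <->
  forall e, 0 < e -> exists x, f x < e /\ g x < e.
Proof.
move=> fB gC; have [[cf f0 fN] _] := fB; have [[cg g0 gN] _] := gC; split.
  move=> [D [BD CD]] e e0; have [h hD] := extension_gauge dP D.
  have [[_ _ hN] _] := hD.
  have [r r0 rf] := (ext_le_coarser dP fB hD).1 BD e e0.
  have [s s0 sg] := (ext_le_coarser dP gC hD).1 CD e e0.
  have [|x] := hN (Num.min r s); first by rewrite lt_min r0.
  by rewrite lt_min => /andP[/rf fx /sg gx]; exists x.
move=> fg; have [|D hD] := @gauge_extension _ _ _ dP
    (fun x => Num.max (f x) (g x)).
  split; first exact: eps_continuous_max.
    by move=> x; rewrite lt_max f0.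
  by move=> e /fg[x [fx gx]]; exists x; rewrite gt_max fx.
exists D; split.
  apply/(ext_le_coarser dP fB hD) => e e0; exists e => // x.
  by rewrite gt_max => /andP[].
apply/(ext_le_coarser dP gC hD) => e e0; exists e => // x.
by rewrite gt_max => /andP[].
Qed.

Lemma glb_coarser_min f g k B C A :
  gauge_of d f B -> gauge_of d g C -> gauge_of d k A -> is_glb B C A ->
  coarser (fun x => Num.min (f x) (g x)) k.
Proof.
move=> fB gC kA [_ _ glb].
have [D mD] := gauge_extension dP (gauge_min fB.1 gC.1).
apply/(ext_le_coarser dP mD kA); apply: glb.
  apply/(ext_le_coarser dP mD fB) => e e0; exists e => // x fx.
  by rewrite gt_min fx.
apply/(ext_le_coarser dP mD gC) => e e0; exists e => // x gx.
by rewrite gt_min gx orbT.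
Qed.

(** If [f] and [c] are far apart and their meet [b] is below the proper gauge
    [a], itself below [f], then the point at infinity of [f] is an isolated
    part of that of [b]. Indeed, on a shell [s <= f <= e'] with [e'] small,
    [c] is at least [e], so [min f c], hence [a], is bounded below: the shell
    of [f] is contained in a shell of [a]. *)
Lemma proper_gauge_clopen_part f c b a : eps_continuous d f ->
  proper_gauge a -> coarser a f -> coarser b a ->
  coarser (fun x => Num.min (f x) (c x)) b ->
  (exists2 e, 0 < e & forall x, f x < e -> c x < e -> False) ->
  proper_gauge f.
Proof.
move=> cf [e1 e10 ac] af ba mb [e e0 fc].
have [r r0 ra] := af e1 e10.
exists (Num.min e r / 2); first by rewrite divr_gt0// lt_min e0.
move=> s s0.
have [t t0 tm] : exists2 t, 0 < t &
    forall x, a x < t -> Num.min (f x) (c x) < Num.min s e.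
  by apply: (coarser_trans mb ba); rewrite lt_min s0.
apply: subclosed_compact (ac t t0) _.
  exact: (eps_continuous_closed_between dP).
move=> x /= /andP[sf fx].
have : f x < Num.min e r.
  by apply: (le_lt_trans fx); rewrite ltr_pdivrMr// ltr_pMr ?lt_min ?e0// ltr1n.
rewrite lt_min => /andP[fe /ra/ltW ->]; rewrite andbT leNgt; apply/negP => /tm.
rewrite gt_min !lt_min ltNge sf /= => /andP[_]; exact: fc.
Qed.

End proper_gauges.

(** * The characterization of locally compact extensions *)

Lemma separable_empty (X : topologicalType) : ~ ([set: X] !=set0) -> separable X.
Proof.
move=> nX; exists set0; first exact: countable0.
by move=> U [x _]; exfalso; apply: nX; exists x.
Qed.

Theorem theorem3p6 (R : realType) (X : topologicalType)
    (CH : continuum_hypothesis)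
    (Xlc : locally_compact [set: X])
    (Xnsep : ~ separable X)
    (Xmet : metrizable R X) :
  let EK := @locally_compact_extensions R X in
  [/\ cond1 EK, cond2 EK & cond3 EK] /\
  forall F : set (extension R X),
    [/\ cond1 F, cond2 F & cond3 F] -> F `<=` EK.
Proof.
have [d dP] := (metrizableP R X).1 Xmet.
have [x0 _] : [set: X] !=set0.
  by apply: contrapT => nX; apply: Xnsep; exact: separable_empty.
have nsep : ~ subseparable d [set: X] by move=> /(subseparable_setT dP).
move=> EK.
have EKP f A : gauge_of d f A -> EK A <-> proper_gauge f.
  exact: locally_compact_gauge.
have EK1 : cond1 EK.
  move=> A EA; have [f fA] := extension_gauge dP A.
  by apply: (proper_gauge_small_upper_cone dP x0 CH fA); apply/(EKP _ _ fA).
have EK2 : cond2 EK.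
  move=> A smallA; have [f fA] := extension_gauge dP A.
  have [e e0 fsep] := subseparable_of_small_upper_cone dP x0 Xlc fA smallA.
  have [g [gg pg gf nfg]] := proper_gauge_below dP x0 Xlc nsep fA.1 e0 fsep.
  have [B gB] := gauge_extension dP gg.
  exists B; first exact/(EKP _ _ gB).
  split; first exact/(ext_le_coarser dP gB fA).
  move=> BA; apply: nfg; apply/(ext_le_coarser dP fA gB); rewrite BA.
  exact: ext_le_refl.
have EK3 : cond3 EK.
  move=> A B EA EB [AB AneB].
  have [f fA] := extension_gauge dP A; have [g gB] := extension_gauge dP B.
  have fg := (ext_le_coarser dP fA gB).1 AB.
  have ngf : ~ coarser g f by move=> /(coarser_anti dP fA gB fg).
  have [h [hg ph fh glb [e e0 gh]]] := proper_gauge_complement dP fA.1 gB.1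
    ((EKP _ _ fA).1 EA) ((EKP _ _ gB).1 EB) fg ngf.
  have [C hC] := gauge_extension dP hg; exists C; split.
  - exact/(EKP _ _ hC).
  - split=> [//||D DB DC]; first exact/(ext_le_coarser dP fA hC).
    have [k kD] := extension_gauge dP D.
    apply/(ext_le_coarser dP kD fA)/glb.
      exact/(ext_le_coarser dP kD gB).
    exact/(ext_le_coarser dP kD hC).
  - move=> /(common_upper_boundP dP gB hC)/(_ e e0)[x [gx hx]].
    exact: gh gx hx.
split=> // F [F1 F2 F3] A FA.
have [A' EA' [A'A A'neA]] := EK2 A (F1 A FA).
have [B FB [BA' BneA']] := F2 A' (EK1 A' EA').
have BltA : ext_lt B A.
  split; first exact: ext_le_trans A'A.
  by move=> BA; apply: BneA'; apply: ext_le_anti => //; rewrite BA.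
have [C [FC glb nub]] := F3 B A FB FA BltA.
have [f fA] := extension_gauge dP A; have [a aA'] := extension_gauge dP A'.
have [b bB] := extension_gauge dP B; have [c cC] := extension_gauge dP C.
have [[cf _ _] _] := fA.
apply/(EKP _ _ fA); apply: (proper_gauge_clopen_part dP cf (a := a) (b := b)).
- exact/(EKP _ _ aA').
- exact/(ext_le_coarser dP aA' fA).
- exact/(ext_le_coarser dP bB aA').
- exact: (glb_coarser_min dP fA cC bB glb).
- apply: contrapT => nc; apply: nub; apply/(common_upper_boundP dP fA cC).
  move=> e e0; apply: contrapT => nx; apply: nc; exists e => // x fx cx.
  by apply: nx; exists x.
Qed.
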